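(* Let $M>m>0$ and let $f,g,h\in L^2_\phi(\Omega)$, with $h(x)\ne 0$ for almost every $x\in\Omega$, be such that the functions $$M\cdot\frac{g}{h}-\frac{f}{h},\qquad \frac{f}{h}-m\cdot\frac{g}{h}$$ are synchronous. Then $$0\le\left|\begin{matrix}\int_\Omega\phi f^2&\int_\Omega\phi fh\\ \int_\Omega\phi fh&\int_\Omega\phi h^2\end{matrix}\right|^{1/2}\left|\begin{matrix}\int_\Omega\phi g^2&\int_\Omega\phi gh\\ \int_\Omega\phi gh&\int_\Omega\phi h^2\end{matrix}\right|^{1/2}-\left|\begin{matrix}\int_\Omega\phi fg&\int_\Omega\phi fh\\ \int_\Omega\phi gh&\int_\Omega\phi h^2\end{matrix}\right|\le\frac12\cdot\frac{(\sqrt M-\sqrt m)^2}{\sqrt{mM}}\left|\begin{matrix}\int_\Omega\phi fg&\int_\Omega\phi fh\\ \int_\Omega\phi gh&\int_\Omega\phi h^2\end{matrix}\right|$$ and $$0\le\left|\begin{matrix}\int_\Omega\phi f^2&\int_\Omega\phi fh\\ \int_\Omega\phi fh&\int_\Omega\phi h^2\end{matrix}\right|\left|\begin{matrix}\int_\Omega\phi g^2&\int_\Omega\phi gh\\ \int_\Omega\phi gh&\int_\Omega\phi h^2\end{matrix}\right|-\left|\begin{matrix}\int_\Omega\phi fg&\int_\Omega\phi fh\\ \int_\Omega\phi gh&\int_\Omega\phi h^2\end{matrix}\right|^2\le\frac14\cdot\frac{(M-m)^2}{mM}\left|\begin{matrix}\int_\Omega\phi fg&\int_\Omega\phi fh\\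 \int_\Omega\phi gh&\int_\Omega\phi h^2\end{matrix}\right|^2 .$$ The constants $\frac12$ in the first display and $\frac14$ in the second display of these determinant inequalities are best possible: neither can be replaced by a smaller constant so that the corresponding inequality still holds for all measure spaces $(\Omega,\Sigma,\mu)$, all measurable $\phi:\Omega\to[0,\infty)$, all $M>m>0$ and all $f,g,h\in L^2_\phi(\Omega)$ with $h\ne0$ almost everywhere such that $M\cdot\frac{g}{h}-\frac{f}{h}$ and $\frac{f}{h}-m\cdot\frac{g}{h}$ are synchronous.
   Context: $(\Omega,\Sigma,\mu)$ is a measure space consisting of a set $\Omega$, a $\sigma$-algebra $\Sigma$ of subsets of $\Omega$ and a countably additive positive measure $\mu$ on $\Sigma$ with values in $\mathbb{R}\cup\{\infty\}$; $\phi:\Omega\to[0,\infty)$ is a measurable function. $L^2_\phi(\Omega)$ denotes the Hilbert space of all real-valued measurable functions $f$ on $\Omega$ with $\int_\Omega\phi(s)|f(s)|^2\,d\mu(s)<\infty$. $\int_\Omega\phi fg$ abbreviates $\int_\Omega\phi(x)f(x)g(x)\,d\mu(x)$ (and similarly for the other integrals), and vertical bars around an array denote the determinant. A pair of real-valued functions $(q,p)$ on $\Omega$ is called synchronous if $(q(x)-q(y))(p(x)-p(y))\ge0$ for almost every $x,y\in\Omega$ (i.e. for $\mu$-almost every $x$, the inequality holds for $\mu$-almost every $y$). *)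

(* Defs.v *)
From HB Require Import structures.
From mathcomp Require Import all_boot all_order all_algebra.
From mathcomp Require Import all_classical all_reals all_analysis.

Set Implicit Arguments.
Unset Strict Implicit.
Unset Printing Implicit Defensive.

Import Order.TTheory GRing.Theory Num.Theory.
Import numFieldNormedType.Exports.

Local Open Scope classical_set_scope.
Local Open Scope ring_scope.

(* Elements are functions, not classes of a.e. equal functions. *)
Definition L2w d (T : measurableType d) (R : realType)
    (mu : {measure set T -> \bar R}) (phi : T -> R) : set (T -> R) :=
  [set f : T -> R | measurable_fun [set: T] f /\
           (\int[mu]_x (phi x * `|f x| ^+ 2)%:E < +oo)%E].

Definition synchronous d (T : measurableType d) (R : realType)
    (mu : {measure set T -> \bar R}) (q p : T -> R) : Prop :=
  \forall x \ae mu, \forall y \ae mu, 0 <= (q x - q y) * (p x - p y).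

(* The integral is real-valued; it is a genuine (finite) integral whenever
   f and g belong to L2w mu phi. *)
Definition wint d (T : measurableType d) (R : realType)
    (mu : {measure set T -> \bar R}) (phi : T -> R) (f g : T -> R) : R :=
  (\int[mu]_x (phi x * f x * g x))%R.

Definition mx22 (R : Type) (a b c d : R) : 'M[R]_2 :=
  \matrix_(i, j) if i == 0 then (if j == 0 then a else b)
                 else (if j == 0 then c else d).

(* | int phi f g   int phi f h |
   | int phi g h   int phi h^2 | *)
Definition wdet d (T : measurableType d) (R : realType)
    (mu : {measure set T -> \bar R}) (phi : T -> R) (h f g : T -> R) : R :=
  \det (mx22 (wint mu phi f g) (wint mu phi f h)
             (wint mu phi g h) (wint mu phi h h)).

Record admissible d (T : measurableType d) (R : realType)
    (mu : {measure set T -> \bar R}) (phi : T -> R) (M m : R)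
    (f g h : T -> R) : Prop := Admissible {
  adm_phi_meas : measurable_fun [set: T] phi ;
  adm_phi_ge0 : forall x, 0 <= phi x ;
  adm_m_gt0 : 0 < m ;
  adm_m_lt_M : m < M ;
  adm_f : L2w mu phi f ;
  adm_g : L2w mu phi g ;
  adm_h : L2w mu phi h ;
  adm_h_neq0 : \forall x \ae mu, h x != 0 ;
  adm_sync : synchronous mu (fun x => M * (g x / h x) - f x / h x)
                            (fun x => f x / h x - m * (g x / h x))
}.

(* Main.v *)
Require Import Defs.
From HB Require Import structures.
From mathcomp Require Import all_boot all_order all_algebra.
From mathcomp Require Import all_classical all_reals all_analysis.
From mathcomp Require Import measurable_realfun ring lra.

Set Implicit Arguments.
Unset Strict Implicit.
Unset Printing Implicit Defensive.

Import Order.TTheory GRing.Theory Num.Theory.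
Import numFieldNormedType.Exports.

Local Open Scope classical_set_scope.
Local Open Scope ring_scope.

(** Write [f, g] for wdet mu phi h f g.  It is a symmetric bilinear form of f
    and g, and it is positive semidefinite by Korkine's identity
      2 [F, G] = int int phi(x) phi(y) (h(y) F(x) - h(x) F(y))
                                       (h(y) G(x) - h(x) G(y)) dmu(y) dmu(x),
    whose integrand is phi(x) phi(y) (h(x) h(y))^2 times
    (q(x) - q(y)) (p(x) - p(y)) when F = q h and G = p h.  Synchrony of q and p
    therefore gives [F, G] >= 0.  The measure is not assumed sigma-finite, so
    Fubini's theorem is avoided: the inner integral in y is expanded by
    bilinearity into an explicit nonnegative combination of F(x), G(x), h(x),
    which is then integrated in x (wdet_ge0).

    For F = M g - f and G = f - m g this says
      [f, f] + m M [g, g] <= (M + m) [f, g]        (sync_wdet_DiazMetcalf),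
    the Diaz-Metcalf form of a reverse Cauchy-Schwarz inequality.  By the
    inequality of the means, 2 sqrt(m M [f, f] [g, g]) <= (M + m) [f, g], and
    both upper bounds follow (reverse_CauchySchwarz); both lower bounds are
    Cauchy-Schwarz for the semidefinite form (wdet_CauchySchwarz).

    Sharpness: near-equality needs [f, f] = m M [g, g] and [M g - f, f - m g]
    small relative to [f, f].  With h = 1, three points of weights e, 1, e and
    functions q, p that differ from a constant only at the first, respectively
    the last point, [q, p] is of order e^2 whereas [q, q] and [p, p] are of
    order e.  Choosing m [q, q] = M [p, p] gives [f, f] = m M [g, g], and the
    ratio [f, g]^2 / ([f, f] [g, g]) tends to its extremal value as e tends
    to 0 (wdet_mu3_ff, wdet_mu3_gg, wdet_mu3_fg). *)

(** * The determinant as a semidefinite bilinear form *)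

Lemma det_mx22 (R : comNzRingType) (a b c d : R) :
  \det (mx22 a b c d) = a * d - b * c.
Proof.
rewrite (expand_det_row _ ord0) !big_ord_recl big_ord0 /cofactor.
by rewrite !det_mx11 !mxE /=; ring.
Qed.

Lemma Rintegral_ae_ge0 d (T : measurableType d) (R : realType)
    (mu : {measure set T -> \bar R}) (K : T -> R) :
  measurable_fun [set: T] K -> (\forall x \ae mu, 0 <= K x) ->
  0 <= \int[mu]_x K x.
Proof.
move=> mK K0; rewrite /Rintegral.
rewrite (@ae_eq_integral _ _ _ mu _ (EFin \o (fun x => `|K x|))) //.
- by rewrite fine_ge0// integral_ge0// => x _; rewrite lee_fin.
- exact/measurable_EFinP.
- by apply/measurable_EFinP; exact: measurableT_comp.
- by apply: filterS K0 => x Kx _; rewrite /= ger0_norm.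
Qed.

Section weighted_form.
Context d (T : measurableType d) (R : realType).
Variables (mu : {measure set T -> \bar R}) (phi : T -> R).
Hypotheses (mphi : measurable_fun [set: T] phi) (phi0 : forall x, 0 <= phi x).
Implicit Types f g h : T -> R.
Local Notation L2 := (L2w mu phi).
Local Notation "<< f , g >>" := (wint mu phi f g).
Local Notation lincomb s f t g := (fun x => s * f x + t * g x).

Lemma L2w_integrable f : L2 f ->
  mu.-integrable [set: T] (EFin \o (fun x => phi x * f x ^+ 2)).
Proof.
move=> [mf fi]; apply/integrableP; split.
  by apply/measurable_EFinP/measurable_funM => //; exact: measurable_funX.
rewrite (eq_integral (fun x => (phi x * `|f x| ^+ 2)%:E))// => x _ /=.
by rewrite ger0_norm ?real_normK ?num_real// mulr_ge0// sqr_ge0.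
Qed.

Lemma measurable_wprod f g : L2 f -> L2 g ->
  measurable_fun [set: T] (fun x => phi x * f x * g x).
Proof.
by move=> [mf _] [mg _]; apply: measurable_funM => //; exact: measurable_funM.
Qed.

(** Dominated by phi * (f ^+ 2 + g ^+ 2). *)
Lemma wprod_integrable f g : L2 f -> L2 g ->
  mu.-integrable [set: T] (EFin \o (fun x => phi x * f x * g x)).
Proof.
move=> Lf Lg.
apply: (@le_integrable _ _ _ mu _ measurableT _
  (EFin \o (fun x => phi x * f x ^+ 2 + phi x * g x ^+ 2))).
- by apply/measurable_EFinP; exact: measurable_wprod.
- move=> x _ /=; rewrite lee_fin [leRHS]ger0_norm; last first.
    by rewrite -mulrDr mulr_ge0// addr_ge0// sqr_ge0.
  rewrite -mulrA normrM (ger0_norm (phi0 x)) -mulrDr ler_wpM2l//.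
  rewrite normrM -(real_normK (num_real (f x))) -(real_normK (num_real (g x))).
  have := normr_ge0 (f x); have := normr_ge0 (g x); nra.
- exact: (integrableD measurableT (L2w_integrable Lf) (L2w_integrable Lg)).
Qed.

(** Dominated through (u + v) ^+ 2 <= 2 * u ^+ 2 + 2 * v ^+ 2. *)
Lemma L2w_lincomb s t f g : L2 f -> L2 g -> L2 (lincomb s f t g).
Proof.
move=> Lf Lg; have [mf _] := Lf; have [mg _] := Lg.
have mc : measurable_fun [set: T] (lincomb s f t g).
  by apply: measurable_funD; apply: measurable_funM.
split=> //.
pose b x := 2 * s ^+ 2 * (phi x * f x ^+ 2) + 2 * t ^+ 2 * (phi x * g x ^+ 2).
have ib : mu.-integrable [set: T] (EFin \o b).
  exact: (integrableD measurableT
    (integrableZl measurableT (2 * s ^+ 2) (L2w_integrable Lf))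
    (integrableZl measurableT (2 * t ^+ 2) (L2w_integrable Lg))).
have /integrableP[] : mu.-integrable [set: T]
    (EFin \o (fun x => phi x * `|s * f x + t * g x| ^+ 2)).
  apply: le_integrable ib => //.
    apply/measurable_EFinP/measurable_funM => //; apply: measurable_funX.
    exact: measurableT_comp.
  move=> x _ /=; rewrite lee_fin real_normK ?num_real// [leRHS]ger0_norm.
    rewrite ger0_norm; last by rewrite mulr_ge0// sqr_ge0.
    rewrite /b [leRHS]
      (_ : _ = phi x * (2 * (s * f x) ^+ 2 + 2 * (t * g x) ^+ 2)).
      apply: ler_wpM2l => //.
      have := sqr_ge0 (s * f x - t * g x); nra.
    by ring.
  by apply: addr_ge0; apply: mulr_ge0; apply: mulr_ge0; rewrite ?sqr_ge0.
move=> _; apply: le_lt_trans; rewrite le_eqVlt; apply/orP; left; apply/eqP.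
apply: eq_integral => x _ /=.
by congr EFin; apply/esym/ger0_norm; rewrite mulr_ge0// sqr_ge0.
Qed.

Lemma wintC f g : << f, g >> = << g, f >>.
Proof. by apply: eq_Rintegral => x _; rewrite mulrAC. Qed.

Lemma wint_linl s t f g k : L2 f -> L2 g -> L2 k ->
  << lincomb s f t g, k >> = s * << f, k >> + t * << g, k >>.
Proof.
move=> Lf Lg Lk; rewrite /wint.
have Hf := wprod_integrable Lf Lk; have Hg := wprod_integrable Lg Lk.
rewrite -!RintegralZl// -RintegralD//.
- by apply: eq_Rintegral => x _; ring.
- exact: (integrableZl measurableT s Hf).
- exact: (integrableZl measurableT t Hg).
Qed.

Lemma wint_linr s t f g k : L2 f -> L2 g -> L2 k ->
  << k, lincomb s f t g >> = s * << k, f >> + t * << k, g >>.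
Proof. by move=> Lf Lg Lk; rewrite wintC wint_linl// !(wintC k). Qed.

Lemma wint_ge0 f g : L2 f -> L2 g -> (\forall x \ae mu, 0 <= f x * g x) ->
  0 <= << f, g >>.
Proof.
move=> Lf Lg fg0; apply: Rintegral_ae_ge0; first exact: measurable_wprod.
by apply: filterS fg0 => x fgx; rewrite -mulrA mulr_ge0.
Qed.

Lemma wdetE h f g :
  wdet mu phi h f g = << f, g >> * << h, h >> - << f, h >> * << g, h >>.
Proof. by rewrite /wdet det_mx22. Qed.

Lemma wdetC h f g : wdet mu phi h f g = wdet mu phi h g f.
Proof. by rewrite !wdetE (wintC f g) (mulrC << f, h >>). Qed.

Lemma wdet_linl h s t f g k : L2 h -> L2 f -> L2 g -> L2 k ->
  wdet mu phi h (lincomb s f t g) k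
    = s * wdet mu phi h f k + t * wdet mu phi h g k.
Proof. by move=> Lh Lf Lg Lk; rewrite !wdetE !wint_linl//; ring. Qed.

Lemma wdet_linr h s t f g k : L2 h -> L2 f -> L2 g -> L2 k ->
  wdet mu phi h k (lincomb s f t g)
    = s * wdet mu phi h k f + t * wdet mu phi h k g.
Proof. by move=> Lh Lf Lg Lk; rewrite wdetC wdet_linl// !(wdetC _ k). Qed.

(** Chebyshev's inequality for the weight phi, written without quotients.  For
    fixed x the integral of the hypothesis in y, against phi y, expands to the
    combination in inner below; integrating that in x against phi x gives
    twice the determinant. *)
Lemma wdet_ge0 h f g : L2 h -> L2 f -> L2 g ->
  (\forall x \ae mu, \forall y \ae mu,
     0 <= (h y * f x - h x * f y) * (h y * g x - h x * g y)) ->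
  0 <= wdet mu phi h f g.
Proof.
move=> Lh Lf Lg sync.
set A := << h, h >>; set B := << g, h >>.
set C := << f, h >>; set D := << f, g >>.
have inner : \forall x \ae mu,
    0 <= f x * (A * g x + - B * h x) + h x * (- C * g x + D * h x).
  apply: filterS sync => x sx.
  have Lu : L2 (lincomb (f x) h (- h x) f) by exact: L2w_lincomb.
  have Lv : L2 (lincomb (g x) h (- h x) g) by exact: L2w_lincomb.
  have : 0 <= << lincomb (f x) h (- h x) f, lincomb (g x) h (- h x) g >>.
    by apply: wint_ge0 => //; apply: filterS sx => y /=; lra.
  rewrite wint_linr// !wint_linl// -/A -/C -/D (wintC h g) -/B.
  lra.
have Lp : L2 (lincomb A g (- B) h) by exact: L2w_lincomb.
have Lq : L2 (lincomb (- C) g D h) by exact: L2w_lincomb.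
suff : 0 <= << f, lincomb A g (- B) h >> + << h, lincomb (- C) g D h >>.
  rewrite !wint_linr// (wintC h g) -/A -/B -/C -/D => pos.
  rewrite wdetE -/A -/B -/C -/D; lra.
have Hf := wprod_integrable Lf Lp; have Hh := wprod_integrable Lh Lq.
rewrite /wint -RintegralD//; apply: Rintegral_ae_ge0.
  by apply: measurable_funD; exact: measurable_wprod.
by apply: filterS inner => x ix; rewrite -!mulrA -mulrDr mulr_ge0.
Qed.

Lemma wdet_self_ge0 h f : L2 h -> L2 f -> 0 <= wdet mu phi h f f.
Proof.
move=> Lh Lf; apply: wdet_ge0 => //.
by apply: nearW => x; apply: nearW => y; rewrite -expr2 sqr_ge0.
Qed.

Lemma wdet_CauchySchwarz h f g : L2 h -> L2 f -> L2 g ->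
  wdet mu phi h f g ^+ 2 <= wdet mu phi h f f * wdet mu phi h g g.
Proof.
move=> Lh Lf Lg.
set a := wdet _ _ _ f f; set b := wdet _ _ _ f g; set c := wdet _ _ _ g g.
have quad s t : 0 <= s ^+ 2 * a + 2 * (s * t) * b + t ^+ 2 * c.
  have Lu : L2 (lincomb s f t g) by exact: L2w_lincomb.
  have := wdet_self_ge0 Lh Lu.
  rewrite wdet_linr// !wdet_linl// (wdetC h g f) -/a -/b -/c.
  lra.
have a0 : 0 <= a by exact: wdet_self_ge0.
have c0 : 0 <= c by exact: wdet_self_ge0.
(* At (c, - b), the minimiser in t for s = c, quad takes the
   value c * (a * c - b ^+ 2).  When c = 0 this says nothing, but at
   (b, - (a + 1)) the value is - (a + 2) * b ^+ 2, which forces b = 0. *)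
have [c_eq0|c_neq0] := eqVneq c 0; last first.
  have c_gt0 : 0 < c by rewrite lt_neqAle eq_sym c_neq0.
  have := quad c (- b).
  rewrite (_ : _ + _ = c * (a * c - b ^+ 2)); last by ring.
  by rewrite pmulr_rge0// subr_ge0.
have := quad b (- (a + 1)); rewrite c_eq0 mulr0 addr0 mulr0.
have := sqr_ge0 b; nra.
Qed.

End weighted_form.

(** * From the additive to the multiplicative inequalities *)

(** Scalar part of the argument, with a, b, c standing for the Gram entries of
    two vectors: the bound a + m M c <= (M + m) b is turned into products by
    the inequality of the means, (sqrt a - sqrt (m M c)) ^+ 2 >= 0 for the
    first conclusion and (a - m M c) ^+ 2 >= 0 for the second. *)
Lemma reverse_CauchySchwarz (R : rcfType) (m M a b c : R) :
  0 < m -> m < M -> 0 <= a -> 0 <= c -> b ^+ 2 <= a * c ->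
  a + m * M * c <= (M + m) * b ->
  (0 <= Num.sqrt a * Num.sqrt c - b
     <= 1 / 2 * ((Num.sqrt M - Num.sqrt m) ^+ 2 / Num.sqrt (m * M)) * b) /\
  (0 <= a * c - b ^+ 2 <= 1 / 4 * ((M - m) ^+ 2 / (m * M)) * b ^+ 2).
Proof.
move=> m0 mM a0 c0 bac Hb.
have M0 : 0 < M by exact: lt_trans mM.
have mM0 : 0 < m * M by exact: mulr_gt0.
have b0 : 0 <= b.
  rewrite -(pmulr_rge0 b (addr_gt0 M0 m0)); apply: le_trans Hb.
  by rewrite addr_ge0// mulr_ge0// ltW.
split; apply/andP; split.
- rewrite subr_ge0 -sqrtrM// -[leLHS]ger0_norm// -sqrtr_sqr.
  by rewrite ler_wsqrtr.
- rewrite sqrtrM ?(ltW m0)//.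
  have: Num.sqrt a ^+ 2 + Num.sqrt m ^+ 2 * Num.sqrt M ^+ 2 * Num.sqrt c ^+ 2
      <= (Num.sqrt M ^+ 2 + Num.sqrt m ^+ 2) * b.
    by rewrite !sqr_sqrtr// ltW.
  have : 0 < Num.sqrt M by rewrite sqrtr_gt0.
  have : 0 < Num.sqrt m by rewrite sqrtr_gt0.
  set u := Num.sqrt m; set v := Num.sqrt M.
  set al := Num.sqrt a; set ga := Num.sqrt c => u0 v0 H.
  rewrite [leRHS](_ : _ = ((v - u) ^+ 2 * b) / (2 * (u * v))); last first.
    by field; rewrite !gt_eqF.
  rewrite ler_pdivlMr ?mulr_gt0//.
  have := sqr_ge0 (al - u * v * ga); nra.
- by rewrite subr_ge0.
- rewrite [leRHS](_ : _ = ((M - m) ^+ 2 * b ^+ 2) / (4 * (m * M))); last first.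
    by field; rewrite !gt_eqF.
  rewrite ler_pdivlMr ?mulr_gt0//.
  have : (a + m * M * c) ^+ 2 <= ((M + m) * b) ^+ 2.
    rewrite ler_sqr// nnegrE; first by rewrite addr_ge0// mulr_ge0// ltW.
    by rewrite mulr_ge0// ltW// addr_gt0.
  have := sqr_ge0 (a - m * M * c); nra.
Qed.

(** * An asymptotically extremal family on three points *)

Section three_points.
Variable R : realType.
Local Notation mu3 := (msum (fun n : nat => @dirac _ nat n R) 3).

Lemma ge0_integral_mu3 (F : nat -> R) : (forall n, 0 <= F n) ->
  (\int[mu3]_x (F x)%:E = (F 0 + F 1 + F 2)%:E)%E.
Proof.
move=> F0; rewrite ge0_integral_measure_sum//; last first.
  by move=> x _; rewrite lee_fin.
under eq_bigr do rewrite integral_dirac// diracT mul1e.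
by rewrite !big_ord_recl big_ord0/= adde0 addrA.
Qed.

Lemma Rintegral_mu3 (F : nat -> R) : \int[mu3]_x F x = F 0 + F 1 + F 2.
Proof.
rewrite /Rintegral integralE.
under [X in (X - _)%E]eq_integral => x _ do rewrite funeposE -EFin_max.
under [X in (_ - X)%E]eq_integral => x _ do rewrite funenegE -EFinN -EFin_max.
rewrite !ge0_integral_mu3 => [| n | n]; rewrite ?le_max ?lexx ?orbT//=.
have mm (x : R) : x = Num.max x 0 - Num.max (- x) 0.
  by rewrite /Num.max; do 2 case: ifPn => ?; lra.
by rewrite [in RHS](mm (F 0)) [in RHS](mm (F 1)) [in RHS](mm (F 2)); ring.
Qed.

(** Constant from index 2 on, so that synchrony holds at every pair of points
    and not merely at those charged by the measure. *)
Definition triple (a b c : R) (n : nat) : R :=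
  if n is k.+1 then (if k is 0 then b else c) else a.

Lemma L2w_mu3 (phi f : nat -> R) : (forall n, 0 <= phi n) -> L2w mu3 phi f.
Proof.
move=> phi0; split=> //; rewrite ge0_integral_mu3 ?ltry// => n.
by rewrite mulr_ge0// sqr_ge0.
Qed.

Variable e : R.
Hypothesis e0 : 0 < e.

Local Notation phi := (triple e 1 e).
(* Here 4 * g - f and f - g are triple (- 6) 0 0 and triple 0 0 3: their
   increments never have opposite signs, and 6 : 3 is the ratio that makes
   [f, f] equal to m M [g, g]. *)
Local Notation f := (triple (- 2) 0 4).
Local Notation g := (triple (- 2) 0 1).
Local Notation h := (fun _ : nat => 1 : R).

Lemma weight_ge0 n : 0 <= phi n.
Proof. by case: n => [|[|n]] /=; rewrite ?ler01 ?ltW. Qed.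

Lemma admissible_mu3 : admissible mu3 phi 4 1 f g h.
Proof.
split; first by [].
- exact: weight_ge0.
- by [].
- by rewrite ltr1n.
- exact/L2w_mu3/weight_ge0.
- exact/L2w_mu3/weight_ge0.
- exact/L2w_mu3/weight_ge0.
- by apply: nearW => x; exact: oner_neq0.
- apply: nearW => x; apply: nearW => y.
  by case: x => [|[|x]]; case: y => [|[|y]] /=; lra.
Qed.

Lemma wdet_mu3_ff : wdet mu3 phi h f f = 4 * (5 * e + 9 * e ^+ 2).
Proof. by rewrite wdetE /wint !Rintegral_mu3 /=; ring. Qed.

Lemma wdet_mu3_gg : wdet mu3 phi h g g = 5 * e + 9 * e ^+ 2.
Proof. by rewrite wdetE /wint !Rintegral_mu3 /=; ring. Qed.

Lemma wdet_mu3_fg : wdet mu3 phi h f g = 8 * e + 18 * e ^+ 2.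
Proof. by rewrite wdetE /wint !Rintegral_mu3 /=; ring. Qed.

End three_points.

(** * The main inequality and its sharpness *)

(** This is 0 <= [M g - f, f - m g], expanded.  Multiplying the synchrony
    inequality at (x, y) by (h x * h y) ^+ 2 clears the quotients. *)
Lemma sync_wdet_DiazMetcalf d (T : measurableType d) (R : realType)
    (mu : {measure set T -> \bar R}) (phi : T -> R) (M m : R)
    (f g h : T -> R) :
  admissible mu phi M m f g h ->
  wdet mu phi h f f + m * M * wdet mu phi h g g
    <= (M + m) * wdet mu phi h f g.
Proof.
move=> [mphi phi0 _ _ Lf Lg Lh h0 sync].
have LF := L2w_lincomb mphi phi0 M (- 1) Lg Lf.
have LG := L2w_lincomb mphi phi0 1 (- m) Lf Lg.
have : 0 <= wdet mu phi h (fun x => M * g x + -1 * f x)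
                          (fun x => 1 * f x + - m * g x).
  apply: wdet_ge0 => //; apply: filterS2 (h0) sync => x hx.
  apply: filterS2 h0 => y hy /(mulr_ge0 (sqr_ge0 (h x * h y))).
  rewrite [X in 0 <= X -> _](_ : _ =
    (h y * (M * g x + -1 * f x) - h x * (M * g y + -1 * f y)) *
    (h y * (1 * f x + - m * g x) - h x * (1 * f y + - m * g y)))//.
  by field; rewrite hx hy.
by rewrite wdet_linr// !wdet_linl// (wdetC _ _ h g f); lra.
Qed.

Theorem proposition3p3 (R : realType) :
  [/\ forall (d : measure_display) (T : measurableType d)
        (mu : {measure set T -> \bar R}) (phi : T -> R) (M m : R)
        (f g h : T -> R),
        admissible mu phi M m f g h ->
        (0 <= Num.sqrt (wdet mu phi h f f) * Num.sqrt (wdet mu phi h g g)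
                - wdet mu phi h f g
           <= 1 / 2 * ((Num.sqrt M - Num.sqrt m) ^+ 2 / Num.sqrt (m * M))
                * wdet mu phi h f g) /\
        (0 <= wdet mu phi h f f * wdet mu phi h g g
                - wdet mu phi h f g ^+ 2
           <= 1 / 4 * ((M - m) ^+ 2 / (m * M)) * wdet mu phi h f g ^+ 2),
      forall c : R, c < 1 / 2 ->
        ~ (forall (d : measure_display) (T : measurableType d)
             (mu : {measure set T -> \bar R}) (phi : T -> R) (M m : R)
             (f g h : T -> R),
             admissible mu phi M m f g h ->
             Num.sqrt (wdet mu phi h f f) * Num.sqrt (wdet mu phi h g g)
                 - wdet mu phi h f g
               <= c * ((Num.sqrt M - Num.sqrt m) ^+ 2 / Num.sqrt (m * M))
                    * wdet mu phi h f g)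
    & forall c : R, c < 1 / 4 ->
        ~ (forall (d : measure_display) (T : measurableType d)
             (mu : {measure set T -> \bar R}) (phi : T -> R) (M m : R)
             (f g h : T -> R),
             admissible mu phi M m f g h ->
             wdet mu phi h f f * wdet mu phi h g g - wdet mu phi h f g ^+ 2
               <= c * ((M - m) ^+ 2 / (m * M)) * wdet mu phi h f g ^+ 2)].
Proof.
split.
- move=> d T mu phi M m f g h adm; have H := sync_wdet_DiazMetcalf adm.
  have [mphi phi0 m0 mM Lf Lg Lh _ _] := adm.
  apply: reverse_CauchySchwarz => //; first exact: wdet_self_ge0.
    exact: wdet_self_ge0.
  exact: wdet_CauchySchwarz.
- (* With sqrt M = 2 and sqrt m = 1 the inequality reads
     2 <= c * (4 + 9 * e); this e keeps the right side below 2. *)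
  move=> c c_lt; pose e := (1 - 2 * c) / 3.
  have e0 : 0 < e by rewrite /e; lra.
  move=> /(_ _ _ _ _ _ _ _ _ _ (admissible_mu3 e0)).
  rewrite wdet_mu3_ff wdet_mu3_gg wdet_mu3_fg.
  have sqrt4 : Num.sqrt (4 : R) = 2.
    by rewrite (_ : 4 = 2 ^+ 2) ?sqrtr_sqr ?ger0_norm//; ring.
  have C0 : 0 <= 5 * e + 9 * e ^+ 2.
    by rewrite addr_ge0// mulr_ge0 ?sqr_ge0 ?ltW.
  rewrite sqrtrM// -mulrA -expr2 sqr_sqrtr// mul1r sqrt4 sqrtr1.
  apply/negP; rewrite -ltNge.
  rewrite [ltLHS](_ : _ = e * (c * (4 + 9 * e))); last by field.
  rewrite [ltRHS](_ : _ = e * 2); last by ring.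
  rewrite ltr_pM2l// /e.
  have [c0|c0] := leP c 0; nra.
- (* The inequality reads 4 + 8 * e <= c * (4 + 9 * e) ^+ 2.  For c > 0 this
     e is at most 1 / 10, so that 81 * e ^+ 2 <= 81 * e and it is enough
     that c * (16 + 153 * e) < 4. *)
  move=> c c_lt; pose e := (1 - 4 * c) / 10.
  have e0 : 0 < e by rewrite /e; lra.
  move=> /(_ _ _ _ _ _ _ _ _ _ (admissible_mu3 e0)).
  rewrite wdet_mu3_ff wdet_mu3_gg wdet_mu3_fg mul1r.
  apply/negP; rewrite -ltNge.
  rewrite [ltLHS](_ : _ = (9 * e ^+ 2) * (c * (4 + 9 * e) ^+ 2)); last by field.
  rewrite [ltRHS](_ : _ = (9 * e ^+ 2) * (4 + 8 * e)); last by ring.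
  have e2 : 0 < 9 * e ^+ 2 by rewrite mulr_gt0// exprn_gt0.
  rewrite ltr_pM2l//.
  have [c0|c0] := leP c 0.
    by apply: (@le_lt_trans _ _ 0); [rewrite mulr_le0_ge0 ?sqr_ge0 | lra].
  have e1 : e <= 1 / 10 by rewrite /e; lra.
  have : c * (16 + 153 * e) < 4 by rewrite /e; nra.
  nra.
Qed.
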